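(* Let $J\subset \mathbb{C}[x,y,z]$ be the defining ideal of a finite set of (fat) points in $\mathbb{P}^2_{\mathbb{C}}$. Then $\beta(J)\le \omega(J)$.
   Context: The defining ideal of a finite set of fat points in $\mathbb{P}^2_{\mathbb{C}}$ is an ideal of the form $J=\bigcap_{i=1}^s I(P_i)^{m_i}$, where $s\ge 1$, $P_1,\dots,P_s\in\mathbb{P}^2_{\mathbb{C}}$ are distinct points, $I(P_i)\subset\mathbb{C}[x,y,z]$ is the homogeneous ideal of all forms vanishing at $P_i$, and $m_i\ge 1$ are integers (all $m_i=1$ gives the ideal of a reduced set of points). For a homogeneous ideal $J\subset\mathbb{C}[x,y,z]$, $[J]_t$ denotes the graded component of $J$ of degree $t$; $\beta(J)$ denotes the smallest integer $t$ such that $[J]_t$ contains a regular sequence of length two (i.e. two forms in $[J]_t$ that form a regular sequence); and $\omega(J)$ denotes the maximum degree of a generator in a set of minimal homogeneous generators of $J$. *)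

(* Defs.v *)
From HB Require Import structures.
From mathcomp Require Import all_boot all_order all_algebra.
From mathcomp Require Import reals complex mpoly.
From Stdlib Require Import ClassicalEpsilon.
Set Implicit Arguments.
Unset Strict Implicit.
Unset Printing Implicit Defensive.
Import GRing.Theory.
Local Open Scope ring_scope.

(* Ideals are [Prop]-valued predicates: membership is not decidable here. *)
Definition ideal_gen (A : comNzRingType) (S : A -> Prop) (x : A) : Prop :=
  exists n (a b : 'I_n -> A),
    (forall i, S (b i)) /\ x = \sum_(i < n) a i * b i.

Definition ideal_pow (A : comNzRingType) (I : A -> Prop) (m : nat) : A -> Prop :=
  ideal_gen (fun y => exists f : 'I_m -> A,
    (forall i, I (f i)) /\ y = \prod_(i < m) f i).

Definition regular_sequence (A : comNzRingType) (s : seq A) : Prop :=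
  (forall k, (k < size s)%N -> forall h : A,
     ideal_gen (fun y => y \in take k s) (s`_k * h) ->
     ideal_gen (fun y => y \in take k s) h)
  /\ ~ ideal_gen (fun y => y \in s) 1.

(* Points of P^2 are given by nonzero coordinate vectors; two such vectors
   give the same point when they are proportional. *)
Definition same_point (K : fieldType) (p q : 'rV[K]_3) : Prop :=
  exists2 c : K, c != 0 & p = c *: q.

Definition point_ideal (K : fieldType) (p : 'rV[K]_3) : {mpoly K[3]} -> Prop :=
  ideal_gen (fun f => (exists d, f \is d.-homog) /\ f.@[fun i => p 0 i] = 0).

Definition fat_points_ideal (K : fieldType) (s : nat)
    (P : 'I_s -> 'rV[K]_3) (m : 'I_s -> nat) (f : {mpoly K[3]}) : Prop :=
  forall i, ideal_pow (point_ideal (P i)) (m i) f.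

Definition graded_part (K : fieldType) (J : {mpoly K[3]} -> Prop) (t : nat)
    (f : {mpoly K[3]}) : Prop := J f /\ f \is t.-homog.

Definition has_regular_pair (K : fieldType) (J : {mpoly K[3]} -> Prop)
    (t : nat) : Prop :=
  exists f g, [/\ graded_part J t f, graded_part J t g
                & regular_sequence [:: f; g]].

Definition is_beta (K : fieldType) (J : {mpoly K[3]} -> Prop) (t : nat) : Prop :=
  has_regular_pair J t /\ forall u, has_regular_pair J u -> (t <= u)%N.

(* [epsilon] returns an unspecified natural number if no value satisfies the
   predicate, so nothing can be proved about [beta] or [omega] without
   showing that they are well defined. *)
Definition beta (K : fieldType) (J : {mpoly K[3]} -> Prop) : nat :=
  epsilon (inhabits 0%N) (is_beta J).

(* Minimality excludes repetitions in [gs] and the generator 0. *)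
Definition min_homog_generators (K : fieldType) (J : {mpoly K[3]} -> Prop)
    (gs : seq {mpoly K[3]}) : Prop :=
  [/\ forall g, g \in gs -> exists d, g \is d.-homog,
      forall f, J f <-> ideal_gen (fun y => y \in gs) f
    & forall g, g \in gs ->
        ~ (forall f, J f <-> ideal_gen (fun y => y \in rem g gs) f)].

(* [msize g] is the total degree of g plus one.  By the graded Nakayama lemma
   the maximal degree does not depend on the choice of [gs]. *)
Definition is_omega (K : fieldType) (J : {mpoly K[3]} -> Prop) (w : nat) : Prop :=
  exists2 gs, min_homog_generators J gs & w = \max_(g <- gs) (msize g).-1.

Definition omega (K : fieldType) (J : {mpoly K[3]} -> Prop) : nat :=
  epsilon (inhabits 0%N) (is_omega J).

(* Main.v *)
Require Import Defs.
From HB Require Import structures.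
From mathcomp Require Import all_boot all_order all_algebra.
From mathcomp Require Import reals complex mpoly zify ring.
From Stdlib Require Import Classical ClassicalEpsilon.
Set Implicit Arguments.
Unset Strict Implicit.
Unset Printing Implicit Defensive.
Import GRing.Theory.
Local Open Scope ring_scope.

(* Let [w] be the largest degree of a generator of [J].  Forms of degree [w] in
   [J] have no common zero other than the given points, since a generator that
   does not vanish at a point can be multiplied by a power of a coordinate.
   Choose a line missing all the points: two general forms [f], [g] of degree [w]
   in [J] have no common zero on it, and such a pair is regular.  Indeed, if
   [g * h = f * k], then on the line [f] divides [h], so [h] is a multiple of [f]
   up to a multiple of the equation [l] of the line; cancelling [l] gives a
   similar relation in smaller degree.  That [omega] is well defined amounts to
   Hilbert's basis theorem, proved here through leading monomials and Dickson's
   lemma. *)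

(** * Ideals and generated ideals *)

Definition is_ideal (A : comNzRingType) (I : A -> Prop) : Prop :=
  [/\ I 0, forall x y, I x -> I y -> I (x + y) & forall a x, I x -> I (a * x)].

Lemma ideal_sum (A : comNzRingType) (I : A -> Prop) (T : Type) (r : seq T)
    (P : pred T) (F : T -> A) :
  is_ideal I -> (forall i, P i -> I (F i)) -> I (\sum_(i <- r | P i) F i).
Proof. by case=> I0 ID _ IF; apply: big_ind. Qed.

Lemma idealB (A : comNzRingType) (I : A -> Prop) (x y : A) :
  is_ideal I -> I x -> I y -> I (x - y).
Proof. by case=> _ ID IM Ix Iy; apply: ID => //; rewrite -mulN1r; apply: IM. Qed.

Lemma ideal_gen_mem (A : comNzRingType) (S : A -> Prop) (x : A) :
  S x -> ideal_gen S x.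
Proof.
by move=> Sx; exists 1%N, (fun=> 1), (fun=> x); split=> //; rewrite big_ord1 mul1r.
Qed.

Lemma ideal_genP (A : comNzRingType) (S : A -> Prop) : is_ideal (ideal_gen S).
Proof.
split=> [|x y [n [a [b [Sb ->]]]] [k [a' [b' [Sb' ->]]]]|c x [n [a [b [Sb ->]]]]].
- by exists 0%N, (fun=> 0), (fun=> 0); split=> [[]|] //; rewrite big_ord0.
- exists (n + k)%N, (fun i => match split i with inl j => a j | inr j => a' j end),
    (fun i => match split i with inl j => b j | inr j => b' j end).
  split=> [i|]; first by case: split.
  rewrite big_split_ord /=; congr (_ + _); apply: eq_bigr => i _.
    by rewrite -[lshift _ _]/(unsplit (inl i)) unsplitK.
  by rewrite -[rshift _ _]/(unsplit (inr i)) unsplitK.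
- exists n, (fun i => c * a i), b; split=> //.
  by rewrite mulr_sumr; apply: eq_bigr => i _; rewrite mulrA.
Qed.

Lemma ideal_powP (A : comNzRingType) (I : A -> Prop) (m : nat) :
  is_ideal (ideal_pow I m).
Proof. exact: ideal_genP. Qed.

Lemma ideal_gen_min (A : comNzRingType) (S I : A -> Prop) :
  is_ideal I -> (forall x, S x -> I x) -> forall x, ideal_gen S x -> I x.
Proof.
move=> idI SI x [n [a [b [Sb ->]]]]; apply: ideal_sum => // i _.
by case: idI => _ _; apply; apply: SI.
Qed.

Lemma vanishing_idealP (K : fieldType) (n : nat) (v : 'I_n -> K) :
  is_ideal (fun f : {mpoly K[n]} => f.@[v] = 0).
Proof.
split=> [|f g f0 g0|a f f0]; first exact: meval0.
  by rewrite mevalD f0 g0 addr0.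
by rewrite mevalM f0 mulr0.
Qed.

(** * Homogeneous components and graded ideals *)

Definition graded (K : fieldType) (n : nat) (I : {mpoly K[n]} -> Prop) : Prop :=
  forall f, I f -> forall d, I (pihomog mdeg d f).

Lemma pihomogMl (K : fieldType) (n d e : nat) (p q : {mpoly K[n]}) :
  p \is d.-homog ->
  pihomog mdeg e (p * q) = if (d <= e)%N then p * pihomog mdeg (e - d) q else 0.
Proof.
move=> hp; rewrite {1}[q](pihomog_partitionE (leqnn (msize q))).
rewrite mulr_sumr linear_sum /=.
have E (j : nat) : pihomog mdeg e (p * pihomog mdeg j q)
    = if (d + j == e)%N then p * pihomog mdeg j q else 0.
  have hj := dhomogM hp (pihomogP mdeg j q).
  case: eqP => [<-|/eqP ne]; first by rewrite pihomog_dE.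
  by rewrite (pihomog_ne0 ne).
under eq_bigr do rewrite E.
case: leqP => [le_de|lt_ed]; last first.
  by rewrite big1 // => j _; case: eqP => // ej; move: lt_ed; rewrite -ej ltnNge leq_addr.
rewrite -big_mkcond /=.
case: (ltnP (e - d) (msize q)) => [lt_s|ge_s].
  rewrite (big_pred1 (Ordinal lt_s)) // => j.
  by rewrite /= -val_eqE /= -{1}(subnKC le_de) eqn_add2l.
rewrite big_pred0 => [|j]; last first.
  apply/negP => /eqP ej; have := ltn_ord j.
  by rewrite ltnNge (leq_trans ge_s) // -ej addKn.
rewrite [pihomog _ _ _]big1_seq ?mulr0 // => m /andP[/eqP hm /msize_mdeg_lt].
by move: hm => /= ->; rewrite ltnNge ge_s.
Qed.

(** The elements all of whose components lie in the ideal form an ideal, because by [pihomogMl] a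
    component of [a * g] is a sum of multiples of components of [g]. *)
Lemma ideal_gen_graded (K : fieldType) (n : nat) (S : {mpoly K[n]} -> Prop) :
  (forall y, S y -> forall d, ideal_gen S (pihomog mdeg d y)) ->
  graded (ideal_gen S).
Proof.
move=> gS f fS d; have idS := ideal_genP S; have [S0 SD SM] := idS.
have: is_ideal (fun g => forall d, ideal_gen S (pihomog mdeg d g)).
  split=> [e|g h Sg Sh e|a g Sg e]; first by rewrite raddf0.
    by rewrite raddfD; exact: SD (Sg e) (Sh e).
  rewrite [a](pihomog_partitionE (leqnn (msize a))) mulr_suml linear_sum /=.
  apply: ideal_sum => // j _; rewrite (pihomogMl _ _ (pihomogP _ _ _)).
  by case: ifP => // _; apply: SM.
by move/ideal_gen_min/(_ gS)/(_ f fS); apply.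
Qed.

(** Splitting each factor into components and distributing turns a product of elements of [I] into a
    sum of homogeneous products of elements of [I]. *)
Lemma ideal_pow_graded (K : fieldType) (n m : nat) (I : {mpoly K[n]} -> Prop) :
  graded I -> graded (ideal_pow I m).
Proof.
move=> gI; apply: ideal_gen_graded => y [f [If ->]] d.
(* A common bound on the sizes makes all factors sums over the same index set, as distributing
   requires. *)
pose D := \max_i msize (f i).
have E i : f i = \sum_(j < D) pihomog mdeg j (f i).
  by apply: pihomog_partitionE; apply: (leq_bigmax_cond (F := fun i => msize (f i))).
under eq_bigr do rewrite E.
rewrite bigA_distr_bigA linear_sum /=; apply: ideal_sum => [|s _].
  exact: ideal_genP.
have hs : \prod_i pihomog mdeg (s i) (f i) \is (\sum_i s i).-homog.
  pose Q (x : {mpoly K[n]}) (d : nat) := x \is d.-homog.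
  apply: (big_rec2 Q) => [|i x e _]; first exact: dhomog1.
  by apply: dhomogM; apply: pihomogP.
have [<-|/eqP ne] := (\sum_i s i)%N =P d.
  rewrite pihomog_dE //; apply: ideal_gen_mem.
  by exists (fun i => pihomog mdeg (s i) (f i)); split=> // i; apply: gI.
by rewrite (pihomog_ne0 ne hs); case: (ideal_powP I m).
Qed.

(** * The ideal of fat points *)

Lemma point_ideal_graded (K : fieldType) (p : 'rV[K]_3) : graded (point_ideal p).
Proof.
apply: ideal_gen_graded => y [[e he] y0] d.
have [<-|/eqP ne] := e =P d.
  by rewrite pihomog_dE //; apply: ideal_gen_mem; split=> //; exists e.
by rewrite (pihomog_ne0 ne he); case: (ideal_genP _ : is_ideal (point_ideal p)).
Qed.

Lemma fat_points_ideal_graded (K : fieldType) (s : nat) (P : 'I_s -> 'rV[K]_3)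
    (m : 'I_s -> nat) :
  graded (fat_points_ideal P m).
Proof.
move=> f Jf d i; apply: ideal_pow_graded (Jf i) d.
exact: point_ideal_graded.
Qed.

Lemma fat_points_idealP (K : fieldType) (s : nat) (P : 'I_s -> 'rV[K]_3)
    (m : 'I_s -> nat) :
  is_ideal (fat_points_ideal P m).
Proof.
split=> [i|f g Jf Jg i|a f Jf i]; have [I0 ID IM] := ideal_powP (point_ideal (P i)) (m i).
- exact: I0.
- exact: ID (Jf i) (Jg i).
- exact: IM (Jf i).
Qed.

Lemma fat_points_ideal_vanish (K : fieldType) (s : nat) (P : 'I_s -> 'rV[K]_3)
    (m : 'I_s -> nat) (i : 'I_s) (f : {mpoly K[3]}) :
  (0 < m i)%N -> fat_points_ideal P m f -> f.@[fun j => P i 0 j] = 0.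
Proof.
have idv := vanishing_idealP (fun j => P i 0 j).
move=> m_gt0 /(_ i); apply: (ideal_gen_min idv) => y [g [Ig ->]].
rewrite rmorph_prod (bigD1 (Ordinal m_gt0)) //=.
suff -> : (g (Ordinal m_gt0)).@[fun j => P i 0 j] = 0 by rewrite mul0r.
by apply: (ideal_gen_min idv) (Ig _) => x [].
Qed.

(** * Dickson's lemma and minimal homogeneous generators *)

(* Induction on the number of coordinates that vary in [S]: if [x0] is in [S],
   an element of [S] not above [x0] lies in one of the finitely many slices
   [mu x i = v] with [v < mu x0 i]. *)
Lemma dickson_free (T : eqType) (n : nat) (mu : T -> 'X_{1..n}) (k : nat)
    (D : {set 'I_n}) (S : T -> Prop) :
  (#|D| < k)%N ->
  (forall x y, S x -> S y -> forall i, i \notin D -> mu x i = mu y i) ->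
  exists ts : seq T, (forall x, x \in ts -> S x) /\
    forall x, S x -> exists2 y, y \in ts & (mu y <= mu x)%MM.
Proof.
elim: k D S => // k IH D S; rewrite ltnS => le_Dk fixS.
have [[x0 Sx0]|noS] := classic (exists x, S x); last first.
  by exists [::]; split=> // x Sx; case: noS; exists x.
pose r := [seq (i, v) | i <- enum D, v <- iota 0 (mu x0 i)].
have [ts [tsS tsP]] : exists ts : seq T, (forall x, x \in ts -> S x) /\
    forall x, S x -> (exists2 iv, iv \in r & mu x iv.1 = iv.2) ->
      exists2 y, y \in ts & (mu y <= mu x)%MM.
  have: {subset r <= r} by [].
  elim: {1 3}r => [_|[i v] r' IHr sub].
    by exists [::]; split=> // x _ [].
  have [|ts [tsS tsP]] := IHr; first by move=> z zr; apply: sub; rewrite inE zr orbT.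
  have iD : i \in D.
    have: (i, v) \in r by apply: sub; rewrite mem_head.
    by case/allpairsPdep => j [u [+ _ [-> _]]]; rewrite mem_enum.
  have [||ts' [ts'S ts'P]] := IH (D :\ i) (fun x => S x /\ mu x i = v).
  - by apply: leq_trans le_Dk; rewrite [X in (_ < X)%N](cardsD1 i) iD.
  - move=> x y [Sx xv] [Sy yv] j; rewrite !inE negb_and negbK.
    by case/orP => [/eqP->|jD]; [rewrite xv yv|apply: fixS].
  exists (ts ++ ts'); split=> [x|x Sx [iv]].
    by rewrite mem_cat => /orP[/tsS|/ts'S[]].
  rewrite inE => /orP[/eqP-> /= xv|ivr xv].
    have [//|y yts yx] := ts'P x; by exists y; rewrite ?mem_cat ?yts ?orbT.
  have [||y yts yx] := tsP x => //; first by exists iv.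
  by exists y; rewrite ?mem_cat ?yts.
exists (x0 :: ts); split=> [x|x Sx].
  by rewrite inE => /orP[/eqP->|/tsS].
have [le_x0x|/mnm_lepP nle] := boolP (mu x0 <= mu x)%MM.
  by exists x0 => //; rewrite mem_head.
have [i lt_xi] : exists i, (mu x i < mu x0 i)%N.
  apply: NNPP => no; apply: nle => i; rewrite leqNgt; apply/negP => lt.
  by apply: no; exists i.
have [||y yts yx] := tsP x => //; last by exists y; rewrite ?inE ?yts ?orbT.
exists (i, mu x i) => //; apply/allpairsPdep; exists i, (mu x i).
split=> //; last by rewrite mem_iota.
rewrite mem_enum; apply: contraTT lt_xi => /(fixS _ _ Sx Sx0) ->.
by rewrite ltnn.
Qed.

Lemma dickson (T : eqType) (n : nat) (mu : T -> 'X_{1..n}) (S : T -> Prop) :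
  exists ts : seq T, (forall x, x \in ts -> S x) /\
    forall x, S x -> exists2 y, y \in ts & (mu y <= mu x)%MM.
Proof.
apply: (@dickson_free _ _ mu #|[set: 'I_n]|.+1 [set: 'I_n]) => // x y _ _ i.
by rewrite inE.
Qed.

(** Dickson's lemma is applied to the nonzero forms of [J] only, so that the generators obtained are
    homogeneous; subtracting multiples of them lowers the leading monomial of a form. *)
Lemma graded_ideal_fin_gen (K : fieldType) (n : nat) (J : {mpoly K[n]} -> Prop) :
  is_ideal J -> graded J ->
  exists2 gs : seq {mpoly K[n]}, (forall g, g \in gs -> exists d, g \is d.-homog)
    & forall f, J f <-> ideal_gen (fun y => y \in gs) f.
Proof.
move=> idJ gJ; have [J0 JD JM] := idJ.
have [gs [gsJ gsP]] := dickson (@mlead n K)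
  (fun g => [/\ J g, g != 0 & exists d, g \is d.-homog]).
exists gs => [g /gsJ[]//|f]; split; last first.
  by apply: ideal_gen_min => // g /gsJ[].
have idG := ideal_genP (fun y => y \in gs); have [G0 GD GM] := idG.
suff main d : forall m g, mlead g = m -> J g -> g \is d.-homog ->
    ideal_gen (fun y => y \in gs) g.
  move=> Jf; rewrite [f](pihomog_partitionE (leqnn (msize f))).
  apply: ideal_sum => // i _; apply: main => //; first exact: gJ.
  exact: pihomogP.
elim/(well_founded_ind (@ltom_wf n)) => m IH g gm Jg hg.
have [->//|g0] := eqVneq g 0.
have [|b bgs le_bg] := gsP g; first by split=> //; exists d.
have [Jb b0 [e hb]] := gsJ b bgs.
have bc0 : b@_(mlead b) != 0 by rewrite mleadc_eq0.
(* The term for which [a * b] has the leading term of [g]. *)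
pose a : {mpoly K[n]} := (g@_m / b@_(mlead b)) *: 'X_[m - mlead b].
have hab : a * b \is d.-homog.
  have -> : d = (mdeg (m - mlead b)%MM + e)%N.
    rewrite -(dhomog_mf hg (mlead_supp g0)) -(dhomog_mf hb (mlead_supp b0)).
    by rewrite gm -mdegD submK // -gm.
  by apply: dhomogM => //; apply: dhomogZ; rewrite dhomogX.
have le_bm : (mlead b <= m)%MM by rewrite -gm.
have cX : ('X_[m - mlead b] * b)@_m = b@_(mlead b).
  by rewrite -(mcoeffMX b (m - mlead b) (mlead b)) submK // mulrC.
have mab : (a * b)@_m = g@_m by rewrite /a -scalerAl mcoeffZ cX divfK.
have lab : mlead (a * b) = m.
  have c0 : g@_m / b@_(mlead b) != 0 by rewrite mulf_neq0 ?invr_eq0 // -gm mleadc_eq0.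
  have X0 : 'X_[m - mlead b] != 0 :> {mpoly K[n]} by rewrite -msupp_eq0 msuppX.
  rewrite /a -scalerAl mleadZ // mleadM //.
  rewrite mleadXm submK //.
rewrite -[g](subrK (a * b)); apply: GD; last by apply/GM/ideal_gen_mem.
have [->//|r0] := eqVneq (g - a * b) 0.
apply: (IH (mlead (g - a * b))) => //.
- rewrite -gm Order.POrderTheory.lt_neqAle; apply/andP; split.
    apply: contraNneq r0 => eq_m; rewrite -mleadc_eq0 eq_m gm mcoeffB mab.
    by rewrite subrr.
  apply: Order.POrderTheory.le_trans (mleadB_le _ _) _.
  by rewrite lab gm Order.JoinTheory.joinxx.
- by apply: idealB => //; apply: JM.
- by rewrite rpredB.
Qed.

(** A redundant generator is discarded as long as there is one; the size of the list bounds the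
    number of rounds. *)
Lemma exists_min_homog_generators (K : fieldType) (J : {mpoly K[3]} -> Prop) :
  is_ideal J -> graded J -> exists gs, min_homog_generators J gs.
Proof.
move=> idJ gJ; have [gs] := graded_ideal_fin_gen idJ gJ.
elim: {gs}(size gs) {-2}gs (leqnn (size gs)) => [|k IH] gs le_k hgs genJ.
  by exists gs; split=> // g; case: gs le_k {hgs genJ}.
have [nored|] := classic (forall g, g \in gs ->
    ~ (forall f, J f <-> ideal_gen (fun y => y \in rem g gs) f)).
  by exists gs.
move=> /not_all_ex_not h; case: h => g h; case: (imply_to_and _ _ h) => ggs /NNPP gen'.
apply: (IH (rem g gs)) => // [|b /mem_rem/hgs//].
by rewrite size_rem // -ltnS (leq_trans _ le_k) // ltn_predL; case: (gs) ggs.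
Qed.

(** * Restriction of forms to a line *)

(** The line passes through [p] exactly when [c] is a root of the polynomial with coefficients [p]
    ([meval_line_form]), so finitely many nonzero vectors exclude only finitely many [c]. *)
Definition line_form (K : fieldType) (c : K) : {mpoly K[3]} :=
  \sum_(i < 3) c ^+ i *: 'X_i.

(* [t |-> (- (c + c ^ 2 t), 1, t)] parametrizes the line [line_form c = 0] except
   for the point [line_infty c]. *)
Definition line_coord (K : fieldType) (c : K) (i : 'I_3) : {poly K} :=
  [:: - (c%:P + c ^+ 2 *: 'X); 1; 'X]`_i.

Definition line_restr (K : fieldType) (c : K) (h : {mpoly K[3]}) : {poly K} :=
  mmap polyC (line_coord c) h.

HB.instance Definition _ (K : fieldType) (c : K) :=
  GRing.RMorphism.copy (line_restr c) (mmap polyC (line_coord c)).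

Definition line_point (K : fieldType) (c t : K) : 'rV[K]_3 :=
  \row_i (line_coord c i).[t].

Definition line_infty (K : fieldType) (c : K) : 'rV[K]_3 :=
  \row_i [:: - c ^+ 2; 0; 1]`_i.

(* For [size p <= d.+1], this is [y ^ d * p (z / y)]. *)
Definition homogenize (K : fieldType) (d : nat) (p : {poly K}) : {mpoly K[3]} :=
  \sum_(j < d.+1)
    p`_j *: ('X_(@Ordinal 3 1 isT) ^+ (d - j) * 'X_(@Ordinal 3 2 isT) ^+ j).

Lemma homogenize_is_linear (K : fieldType) (d : nat) : linear (@homogenize K d).
Proof.
move=> a p q; rewrite /homogenize scaler_sumr -big_split /=; apply: eq_bigr => j _.
by rewrite coefD coefZ scalerDl scalerA.
Qed.

HB.instance Definition _ (K : fieldType) (d : nat) :=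
  GRing.isLinear.Build K {poly K} {mpoly K[3]} _ (@homogenize K d)
    (@homogenize_is_linear K d).

Lemma homogenizeXn (K : fieldType) (d j : nat) : (j <= d)%N ->
  homogenize d 'X^j = 'X_(@Ordinal 3 1 isT) ^+ (d - j) * 'X_(@Ordinal 3 2 isT) ^+ j
    :> {mpoly K[3]}.
Proof.
rewrite -ltnS => lt_jd; rewrite /homogenize (bigD1 (Ordinal lt_jd)) //=.
rewrite coefXn eqxx scale1r.
rewrite big1 ?addr0 // => i /eqP ne.
rewrite coefXn; case: eqP => [e|]; last by rewrite scale0r.
by case: ne; apply: val_inj.
Qed.

(** Both sides are bilinear, so monomials suffice; the size bounds ensure that [homogenize], which
    cuts off high coefficients, loses nothing. *)
Lemma homogenizeM (K : fieldType) (d e : nat) (p q : {poly K}) :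
  (size p <= d.+1)%N -> (size q <= e.+1)%N ->
  homogenize (d + e) (p * q) = homogenize d p * homogenize e q.
Proof.
have sumX (r : {poly K}) k : (size r <= k.+1)%N -> r = \sum_(i < k.+1) r`_i *: 'X^i.
  move=> sr; rewrite -poly_def; apply/polyP => i; rewrite coef_poly.
  by case: ltnP => // ge_i; rewrite nth_default // (leq_trans sr).
move=> /sumX -> /sumX ->; rewrite mulr_suml !linear_sum mulr_suml /=.
apply: eq_bigr => i _.
rewrite mulr_sumr !linear_sum mulr_sumr /=; apply: eq_bigr => j _.
have [le_i le_j] : (i <= d)%N /\ (j <= e)%N by split; rewrite -ltnS.
rewrite -scalerAl -scalerAr -exprD !linearZ /= !homogenizeXn ?leq_add //.
rewrite -scalerAl -scalerAr; do 2!congr (_ *: _).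
rewrite mulrACA -!exprD; congr (_ ^+ _ * _).
lia.
Qed.

Lemma homogenize_homog (K : fieldType) (d : nat) (p : {poly K}) :
  homogenize d p \is d.-homog.
Proof.
apply: rpred_sum => j _; apply: rpredZ.
have e : (1 * (d - j) + 1 * j)%N = d by have := ltn_ord j; lia.
have hX i : ('X_i : {mpoly K[3]}) \is 1%N.-homog by rewrite dhomogX /= mdeg1.
by have := dhomogM (dhomogMn (d - j) (hX _)) (dhomogMn j (hX _)); rewrite e; apply.
Qed.

(** Division by [line_form c], in which the first variable has coefficient 1: the remainder is a
    form in the other two variables, recovered from the restriction. The property passes to products
    and to linear combinations within a degree, so checking 1 and the variables is enough. *)
Lemma line_division (K : fieldType) (c : K) (d : nat) (h : {mpoly K[3]}) :
  h \is d.-homog ->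
  (size (line_restr c h) <= d.+1)%N /\
  exists r, h = homogenize d (line_restr c h) + line_form c * r.
Proof.
pose T d (h : {mpoly K[3]}) := (size (line_restr c h) <= d.+1)%N /\
  exists r, h = homogenize d (line_restr c h) + line_form c * r.
have TM d1 d2 h1 h2 : T d1 h1 -> T d2 h2 -> T (d1 + d2)%N (h1 * h2).
  move=> [s1 [r1 e1]] [s2 [r2 e2]]; rewrite /T rmorphM /=; split.
    apply: leq_trans (size_polyMleq _ _) _.
    lia.
  rewrite homogenizeM //; set H1 := homogenize _ _; set H2 := homogenize _ _.
  exists (r1 * h2 + H1 * r2); rewrite {1}e1 -/H1 mulrDl {1}e2 -/H2; ring.
have T1 : T 0 1.
  rewrite /T rmorph1 size_poly1; split=> //; exists 0.
  by have := @homogenizeXn K 0 0 isT; rewrite !expr0 mulr1 mulr0 addr0.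
have TX i : T 1%N 'X_i.
  have e1 : homogenize 1 1 = 'X_(@Ordinal 3 1 isT) :> {mpoly K[3]}.
    by have := @homogenizeXn K 1 0 isT; rewrite subn0 !expr0 expr1 mulr1.
  have e2 : homogenize 1 'X = 'X_(@Ordinal 3 2 isT) :> {mpoly K[3]}.
    by have := @homogenizeXn K 1 1 isT; rewrite subnn expr0 !expr1 mul1r.
  have eX : line_restr c 'X_i = line_coord c i by rewrite /line_restr mmapX mmap1U.
  rewrite /T eX {eX}.
  case: i => [[|[|[|//]]] lt_i]; rewrite /line_coord /=.
  - split.
      rewrite size_polyN (leq_trans (size_polyD _ _)) // geq_max.
      rewrite (leq_trans (size_polyC_leq1 _)) //.
      by rewrite (leq_trans (size_scale_leq _ _)) // size_polyX.
    exists 1; rewrite mulr1 -alg_polyC linearN linearD !linearZ /= e1 e2.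
    rewrite /line_form !big_ord_recl big_ord0 addr0 /= expr0 expr1 scale1r addrCA.
    have o1 : lift ord0 ord0 = @Ordinal 3 1 isT by apply: val_inj.
    have o2 : lift ord0 (lift ord0 ord0) = @Ordinal 3 2 isT by apply: val_inj.
    have o0 : Ordinal lt_i = ord0 by apply: val_inj.
    by rewrite o0 o1 o2 addNr addr0.
  - rewrite size_poly1; split=> //; exists 0; rewrite e1 mulr0 addr0.
    by congr 'X_[U_(_)]; apply: val_inj.
  - rewrite size_polyX; split=> //; exists 0; rewrite e2 mulr0 addr0.
    by congr 'X_[U_(_)]; apply: val_inj.
have TXn i k : T k ('X_i ^+ k).
  by elim: k => [|k IHk]; rewrite ?exprS //; apply: (TM 1%N k).
have TXm m : T (mdeg m) 'X_[m].
  rewrite mpolyXE_id mdegE; apply: (big_rec2 T) => // i x e _; exact: TM.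
move=> hh; rewrite -/(T d h) [h]mpolyE big_seq; apply: big_rec => [|m p mh [sp [r ep]]].
  by rewrite /T !raddf0 size_poly0; split=> //; exists 0; rewrite mulr0 addr0.
have [sm [rm em]] := TXm m; rewrite (dhomog_mf hh mh) in sm em.
have eZ : line_restr c (h@_m *: 'X_[m] + p) =
    h@_m *: line_restr c 'X_[m] + line_restr c p.
  by rewrite raddfD /=; congr (_ + _); rewrite /line_restr mmapZ mul_polyC.
rewrite /T eZ; split.
  rewrite (leq_trans (size_polyD _ _)) // geq_max sp andbT.
  by rewrite (leq_trans (size_scale_leq _ _)).
exists (h@_m *: rm + r); rewrite linearP /= {1}em {1}ep mulrDr scalerDr -scalerAr.
by rewrite addrACA.
Qed.

Lemma horner_line_restr (K : fieldType) (c t : K) (h : {mpoly K[3]}) :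
  (line_restr c h).[t] = h.@[fun i => line_point c t 0 i].
Proof.
rewrite [h]mpolyE !raddf_sum horner_sum /=; apply: eq_bigr => m _.
rewrite /line_restr mmapZ mevalZ hornerM hornerC mmapX mevalX horner_prod.
by congr (_ * _); apply: eq_bigr => i _; rewrite horner_exp mxE.
Qed.

Lemma meval_line_form (K : fieldType) (c : K) (p : 'rV[K]_3) :
  (line_form c).@[fun i => p 0 i] = (rVpoly p).[c].
Proof.
rewrite /line_form raddf_sum /= horner_poly; apply: eq_bigr => i _.
by rewrite mevalZ mevalXU mulrC (valK i).
Qed.

Lemma line_form_line_point (K : fieldType) (c t : K) :
  (line_form c).@[fun i => line_point c t 0 i] = 0.
Proof.
rewrite /line_form raddf_sum /= !big_ord_recl big_ord0 /= !mevalZ !mevalXU !mxE.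
rewrite /line_coord /= !hornerE /=; ring.
Qed.

Lemma line_form_line_infty (K : fieldType) (c : K) :
  (line_form c).@[fun i => line_infty c 0 i] = 0.
Proof.
rewrite /line_form raddf_sum /= !big_ord_recl big_ord0 /= !mevalZ !mevalXU !mxE /=.
ring.
Qed.

(** In the remainder of [line_division], the last two coordinates 0 and 1 of [line_infty c] leave
    only the coefficient of degree [d]. A form nonzero at this point thus has a restriction of full
    size. *)
Lemma coef_line_restr (K : fieldType) (c : K) (d : nat) (h : {mpoly K[3]}) :
  h \is d.-homog -> (line_restr c h)`_d = h.@[fun i => line_infty c 0 i].
Proof.
case/(line_division c) => _ [r {2}->].
rewrite mevalD mevalM line_form_line_infty mul0r addr0 raddf_sum /=.
rewrite big_ord_recr big1 /= => [|i _].
  by rewrite add0r mevalZ mevalM subnn expr0 meval1 rmorphXn /= mevalXU mxE /=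
    expr1n mul1r mulr1.
rewrite mevalZ mevalM rmorphXn /= mevalXU mxE /= expr0n.
by rewrite subn_eq0 leqNgt ltn_ord mul0r mulr0.
Qed.

Lemma line_form_neq0 (K : fieldType) (c : K) : line_form c != 0.
Proof.
apply/eqP => l0; have := meval_line_form c (delta_mx 0 0).
rewrite l0 meval0 rVpoly_delta expr0 hornerE => /esym/eqP.
by rewrite oner_eq0.
Qed.

Lemma line_form_homog (K : fieldType) (c : K) : line_form c \is 1.-homog.
Proof. by apply: rpred_sum => i _; apply: rpredZ; rewrite dhomogX /= mdeg1. Qed.

(** * Syzygies and regular pairs from coprime restrictions *)

(** The remainders of [g] and [h] modulo [line_form c] differ by the factor [homogenize (d - w) q],
    by [homogenizeM]. *)
Lemma line_restr_lift (K : fieldType) (c : K) (d w : nat) (g h : {mpoly K[3]})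
    (q : {poly K}) :
  g \is w.-homog -> h \is d.-homog -> (w <= d)%N -> (size q <= (d - w).+1)%N ->
  line_restr c h = line_restr c g * q ->
  exists r, h = g * homogenize (d - w) q + line_form c * r.
Proof.
move=> hg hh le_wd sq e.
have [sg [rg eg]] := line_division c hg; have [_ [rh eh]] := line_division c hh.
rewrite e -{1}(subnKC le_wd) homogenizeM // in eh.
exists (rh - rg * homogenize (d - w) q); rewrite {1}eh {2}eg; ring.
Qed.

(** Comparing components of degree [d] replaces [r] by its component of degree one less; for [d = 0]
    nothing is left. *)
Lemma line_form_quotient_homog (K : fieldType) (c : K) (d : nat)
    (p r : {mpoly K[3]}) :
  p \is d.-homog -> p = line_form c * r ->
  if d is d'.+1 then exists2 r', r' \is d'.-homog & p = line_form c * r'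
  else p = 0.
Proof.
move=> hp e; have := pihomogMl d r (line_form_homog c).
rewrite -e pihomog_dE //; case: d {hp} => [//|d]; rewrite ltnS leq0n subSS subn0.
by move=> ->; exists (pihomog mdeg d r) => //; apply: pihomogP.
Qed.

Lemma line_coprime_syzygy (K : fieldType) (c : K) (w d : nat)
    (f g h k : {mpoly K[3]}) :
  f \is w.-homog -> g \is w.-homog -> f.@[fun i => line_infty c 0 i] != 0 ->
  coprimep (line_restr c f) (line_restr c g) ->
  h \is d.-homog -> k \is d.-homog -> g * h = f * k -> exists q, h = q * f.
Proof.
move=> hf hg f0 cop; set l := line_form c.
(* The same [Q] serves for [a] and [b]: it lifts the quotient of [line_restr c a] by
   [line_restr c f], which exists by coprimality. *)
have lift e a b : a \is e.-homog -> b \is e.-homog -> g * a = f * b ->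
    exists Q r s, [/\ a = f * Q + l * r, b = g * Q + l * s,
      f * Q \is e.-homog & g * Q \is e.-homog].
  move=> ha hb eab.
  have ephi : line_restr c g * line_restr c a = line_restr c f * line_restr c b.
    by rewrite -!rmorphM /= eab.
  have phifw : (line_restr c f)`_w != 0 by rewrite (coef_line_restr c hf).
  have phif0 : line_restr c f != 0 by apply: contraNneq phifw => ->; rewrite coef0.
  have /dvdpP[q eq_a] : line_restr c f %| line_restr c a.
    by rewrite -(Gauss_dvdpr _ cop) ephi dvdp_mulr.
  have eq_b : line_restr c b = line_restr c g * q.
    by apply: (mulfI phif0); rewrite -ephi eq_a; ring.
  have [sa [ra ea]] := line_division c ha; have [sb [rb eb]] := line_division c hb.
  (* The zero quotient is set apart, since it does not force [w <= e]. *)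
  have [q0|q_neq0] := eqVneq q 0.
    exists 0, ra, rb; rewrite !mulr0 rpred0; split=> //.
      by rewrite {1}ea eq_a q0 mul0r raddf0.
    by rewrite {1}eb eq_b q0 mulr0 raddf0.
  have sf : (w < size (line_restr c f))%N.
    by rewrite ltnNge; apply: contra phifw => /leq_sizeP ->.
  have q_gt0 : (0 < size q)%N by rewrite size_poly_gt0.
  (* As [f] is nonzero at [line_infty c], its restriction has size above [w], which bounds
     [size q]. *)
  have [le_we sq] : (w <= e)%N /\ (size q <= (e - w).+1)%N.
    move: sa sf q_gt0; rewrite eq_a size_mul //.
    by move: (size _) (size _) => m n; lia.
  have [r er] := line_restr_lift hf ha le_we sq (etrans eq_a (mulrC _ _)).
  have [s es] := line_restr_lift hg hb le_we sq eq_b.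
  have hQ (y : {mpoly K[3]}) : y \is w.-homog -> y * homogenize (e - w) q \is e.-homog.
    by move=> hy; have := dhomogM hy (homogenize_homog (e - w) q); rewrite subnKC.
  by exists (homogenize (e - w) q), r, s; split=> //; apply: hQ.
elim: d h k => [|d IH] h k hh hk e.
all: have [Q [r [s [eh ek hfQ hgQ]]]] := lift _ _ _ hh hk e.
  (* In degree 0, the multiple [h - f * Q] of [l] is 0. *)
  have := @line_form_quotient_homog _ c 0 (h - f * Q) r (rpredB hh hfQ).
  rewrite {1}eh addrC addKr => /(_ erefl)/eqP.
  by rewrite subr_eq0 => /eqP ->; exists Q; rewrite mulrC.
have [||r' hr' er] := @line_form_quotient_homog _ c d.+1 (h - f * Q) r.
- exact: rpredB.
- by rewrite eh addrC addKr.
have [||s' hs' es] := @line_form_quotient_homog _ c d.+1 (k - g * Q) s.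
- exact: rpredB.
- by rewrite ek addrC addKr.
(* Cancelling [l] leaves [g * r' = f * s'], with [r'] and [s'] of degree [d]. *)
rewrite -/l in er es; have [//|//||q eq] := IH r' s'; last first.
  by exists (Q + l * q); rewrite -[h](subrK (f * Q)) er eq; ring.
apply: (mulfI (line_form_neq0 c)); rewrite -/l mulrCA -er [RHS]mulrCA -es.
by rewrite !mulrBr e; ring.
Qed.

Lemma ideal_gen_nil (A : comNzRingType) (x : A) :
  ideal_gen (fun y => y \in [::]) x <-> x = 0.
Proof.
split=> [|->]; last by case: (ideal_genP (fun y : A => y \in [::])).
apply: (@ideal_gen_min _ _ (fun x => x = 0)) => //.
by split=> [|y z -> ->|a y ->]; rewrite ?addr0 ?mulr0.
Qed.

Lemma ideal_gen_seq1 (A : comNzRingType) (f x : A) :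
  ideal_gen (fun y => y \in [:: f]) x <-> exists a, x = a * f.
Proof.
split=> [|[a ->]]; last first.
  have [_ _] := ideal_genP (fun y => y \in [:: f]); apply.
  by apply: ideal_gen_mem; rewrite inE.
apply: (@ideal_gen_min _ _ (fun x => exists a, x = a * f)) => [|y]; last first.
  by rewrite inE => /eqP ->; exists 1; rewrite mul1r.
split=> [|y z [a ->] [b ->]|a y [b ->]]; first by exists 0; rewrite mul0r.
  by exists (a + b); rewrite mulrDl.
by exists (a * b); rewrite mulrA.
Qed.

(** The common zero [p] keeps 1 out of the ideal of [f] and [g]; the other conditions are that [f]
    is nonzero and [line_coprime_syzygy]. *)
Lemma line_coprime_regular (K : fieldType) (c : K) (w : nat) (f g : {mpoly K[3]})
    (p : 'rV[K]_3) :
  f \is w.-homog -> g \is w.-homog -> f.@[fun i => line_infty c 0 i] != 0 ->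
  coprimep (line_restr c f) (line_restr c g) ->
  f.@[fun i => p 0 i] = 0 -> g.@[fun i => p 0 i] = 0 ->
  regular_sequence [:: f; g].
Proof.
move=> hf hg f0 cop fp gp; split; last first.
  move=> h1; suff : (1 : {mpoly K[3]}).@[fun i => p 0 i] = 0.
    by apply/eqP; rewrite meval1 oner_eq0.
  apply: (ideal_gen_min (vanishing_idealP _)) h1.
  by move=> y; rewrite !inE => /orP[]/eqP->.
case=> [|[|//]] _ h /=.
  move/ideal_gen_nil/eqP; rewrite mulf_eq0 => /orP[/eqP fz|/eqP ->].
    by move: f0; rewrite fz meval0 eqxx.
  exact/ideal_gen_nil.
(* Since [f] and [g] have the same degree, the relation [g * h = a * f] splits into relations
   between components of [h] and [a] of equal degree. *)
case/ideal_gen_seq1 => a e; rewrite [h](pihomog_partitionE (leqnn (msize h))).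
apply: ideal_sum => [|i _]; first exact: ideal_genP.
apply/ideal_gen_seq1/(line_coprime_syzygy hf hg f0 cop (pihomogP _ _ h) (pihomogP _ _ a)).
have := pihomogMl (w + i) h hg; rewrite e mulrC (pihomogMl _ _ hf) leq_addr addKn.
exact: esym.
Qed.

(** * General members of a linear system *)

Lemma common_nonroot (K : closedFieldType) (T : eqType) (r : seq T)
    (F : T -> {poly K}) :
  (forall x, x \in r -> F x != 0) ->
  exists c, forall x, x \in r -> (F x).[c] != 0.
Proof.
move=> F0; have /closed_nonrootP[c] : \prod_(x <- r) F x != 0.
  by rewrite prodf_seq_neq0; apply/allP => x xr; apply: F0.
by rewrite rootE horner_prod prodf_seq_neq0 => /allP Fc; exists c.
Qed.

(** Induction on the points: at each of them the value of [g + a *: g'] is a nonzero polynomial in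
    [a], and some [a] is a root of none of these. *)
Lemma common_nonzero (K : closedFieldType) (n : nat) (V : {mpoly K[n]} -> Prop)
    (T : eqType) (r : seq T) (pt : T -> 'I_n -> K) :
  V 0 -> (forall a f g, V f -> V g -> V (f + a *: g)) ->
  (forall x, x \in r -> exists2 g, V g & g.@[pt x] != 0) ->
  exists2 g, V g & forall x, x \in r -> g.@[pt x] != 0.
Proof.
move=> V0 VP; elim: r => [|x r IH] hr; first by exists 0.
have [|g Vg gr] := IH; first by move=> y yr; apply: hr; rewrite inE yr orbT.
have [g' Vg' g'x] := hr x (mem_head _ _).
have [|a ha] := @common_nonroot K T (x :: r)
    (fun y => (g.@[pt y])%:P + g'.@[pt y] *: 'X).
  move=> y yr; apply/eqP => /polyP e.
  move: (e 0%N) (e 1%N); rewrite !coefD !coefZ !coefC !coefX /= mulr0 mulr1 addr0 add0r.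
  move=> gy g'y; move: yr; rewrite inE => /orP[/eqP yx|/gr]; last by rewrite gy eqxx.
  by move: g'x; rewrite -yx g'y eqxx.
exists (g + a *: g'); first exact: VP.
move=> y /ha; rewrite mevalD mevalZ hornerD hornerC hornerZ hornerX.
by rewrite mulrC.
Qed.

(** With [f] nonzero at [line_infty c], its zeros on the line correspond to the roots of
    [line_restr c f]. Choosing [g] nonzero at all of them leaves the restrictions without common
    root, hence coprime. *)
Lemma line_base_point_free_regular (K : closedFieldType) (c : K) (w : nat)
    (V : {mpoly K[3]} -> Prop) (p : 'rV[K]_3) :
  V 0 -> (forall a f g, V f -> V g -> V (f + a *: g)) ->
  (forall f, V f -> f \is w.-homog) ->
  (forall f, V f -> f.@[fun i => p 0 i] = 0) ->
  (forall q : 'rV[K]_3, q != 0 -> (line_form c).@[fun i => q 0 i] = 0 ->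
     exists2 f, V f & f.@[fun i => q 0 i] != 0) ->
  exists f g, [/\ V f, V g & regular_sequence [:: f; g]].
Proof.
move=> V0 VP Vh Vp Vl.
have [||f Vf f0] := Vl (line_infty c).
- by apply/rV0Pn; exists (@Ordinal 3 2 isT); rewrite mxE /= oner_neq0.
- exact: line_form_line_infty.
have hf := Vh _ Vf.
have phif0 : line_restr c f != 0.
  by apply: contraNneq f0 => z; rewrite -(coef_line_restr c hf) z coef0.
have [rs ers] := closed_field_poly_normal (line_restr c f).
have [|g Vg gr] := @common_nonzero K 3 V K rs (fun t i => line_point c t 0 i) V0 VP.
  move=> t _; apply: Vl (line_form_line_point c t).
  apply/rV0Pn; exists (@Ordinal 3 1 isT).
  by rewrite !mxE /line_coord /= hornerC oner_neq0.
exists f, g; split=> //.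
apply: (line_coprime_regular (p := p) hf (Vh _ Vg) f0); [|exact: Vp|exact: Vp].
apply/Pdiv.ClosedField.coprimepP => t ft; apply/negP => gt.
have tr : t \in rs.
  by move: ft; rewrite ers rootZ ?lead_coef_eq0 // root_prod_XsubC.
by have := gr t tr; rewrite -horner_line_restr (eqP gt) eqxx.
Qed.

(** * Forms in the ideal that are nonzero at a given point *)

(** The form is a minor of the matrix with rows [p] and the variables. With [q 0 b] nonzero, some
    column [a] gives a minor nonzero at [q], for otherwise [p] would be a multiple of [q]. *)
Lemma separating_linear_form (K : fieldType) (n : nat) (p q : 'rV[K]_n) :
  q != 0 -> (forall a, p <> a *: q) ->
  exists l : {mpoly K[n]}, [/\ l \is 1.-homog, l.@[fun i => p 0 i] = 0
    & l.@[fun i => q 0 i] != 0].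
Proof.
move=> /rV0Pn[b qb] npq.
have [a ne] : exists a, p 0 a * q 0 b != p 0 b * q 0 a.
  apply: NNPP => no; apply: (npq (p 0 b / q 0 b)); apply/rowP => a; rewrite mxE.
  have [e|ne] := eqVneq (p 0 a * q 0 b) (p 0 b * q 0 a); last by case: no; exists a.
  by rewrite mulrAC -e mulfK.
exists (p 0 a *: 'X_b - p 0 b *: 'X_a); split.
- by apply: rpredB; apply: rpredZ; rewrite dhomogX /= mdeg1.
- by rewrite mevalB !mevalZ !mevalXU mulrC subrr.
- by rewrite mevalB !mevalZ !mevalXU subr_eq0.
Qed.

(** Take the product of the [l i ^+ m i], where the linear form [l i] vanishes at [P i] but not at
    [q]. *)
Lemma fat_points_ideal_separates (K : fieldType) (s : nat) (P : 'I_s -> 'rV[K]_3)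
    (m : 'I_s -> nat) (q : 'rV[K]_3) :
  q != 0 -> (forall i a, P i <> a *: q) ->
  exists2 f, fat_points_ideal P m f & f.@[fun i => q 0 i] != 0.
Proof.
move=> q0 Pq.
have sep i := constructive_indefinite_description _ (separating_linear_form q0 (Pq i)).
pose l i := sval (sep i).
have lP i : [/\ l i \is 1.-homog, (l i).@[fun j => P i 0 j] = 0
    & (l i).@[fun j => q 0 j] != 0] by exact: svalP (sep i).
exists (\prod_i l i ^+ m i) => [i|].
  rewrite (bigD1 i) //= mulrC; have [_ _] := ideal_powP (point_ideal (P i)) (m i).
  apply; apply: ideal_gen_mem; exists (fun=> l i); split.
    move=> _; apply: ideal_gen_mem; have [hl l0 _] := lP i.
    by split=> //; exists 1%N.
  by rewrite prodr_const card_ord.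
rewrite rmorph_prod; apply/prodf_neq0 => i _ /=; rewrite rmorphXn expf_neq0 //.
by case: (lP i).
Qed.

Lemma generators_base_point (K : fieldType) (J : {mpoly K[3]} -> Prop)
    (gs : seq {mpoly K[3]}) (q : 'rV[K]_3) (f : {mpoly K[3]}) :
  min_homog_generators J gs -> q != 0 -> J f -> f.@[fun i => q 0 i] != 0 ->
  exists2 g, graded_part J (\max_(g <- gs) (msize g).-1) g
    & g.@[fun i => q 0 i] != 0.
Proof.
move=> [hgs Jgs _] /rV0Pn[b qb] /Jgs Jf fq.
have [g ggs gq] : exists2 g, g \in gs & g.@[fun i => q 0 i] != 0.
  apply: NNPP => no; move/eqP: fq; apply.
  apply: (ideal_gen_min (vanishing_idealP _)) Jf.
  by move=> y ys; apply/eqP; apply: contraT => yq; case: no; exists y.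
have [d hd] := hgs g ggs.
have g0 : g != 0 by apply: contraNneq gq => ->; rewrite meval0.
set w := \max_(g <- gs) _.
have le_dw : (d <= w)%N.
  have -> : d = (msize g).-1 by rewrite -mlead_deg //= (dhomog_mf hd (mlead_supp g0)).
  exact: (leq_bigmax_seq (F := fun g => (msize g).-1)).
exists ('X_b ^+ (w - d) * g); last first.
  by rewrite mevalM rmorphXn /= mevalXU mulf_neq0 ?expf_neq0.
split.
  by apply/Jgs; have [_ _] := ideal_genP (fun y => y \in gs); apply; apply: ideal_gen_mem.
have hX : ('X_b : {mpoly K[3]}) \is 1%N.-homog by rewrite dhomogX /= mdeg1.
by have := dhomogM (dhomogMn (w - d) hX) hd; rewrite mul1n subnK.
Qed.

(** * The regular pair and the inequality *)

Lemma fat_points_regular_pair (K : closedFieldType) (s : nat) (P : 'I_s -> 'rV[K]_3)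
    (m : 'I_s -> nat) (gs : seq {mpoly K[3]}) :
  (0 < s)%N -> (forall i, P i != 0) -> (forall i, (0 < m i)%N) ->
  min_homog_generators (fat_points_ideal P m) gs ->
  has_regular_pair (fat_points_ideal P m) (\max_(g <- gs) (msize g).-1).
Proof.
move=> s_gt0 P0 m_gt0 gens; set J := fat_points_ideal P m; set w := \max_(g <- gs) _.
have [J0 JD JM] : is_ideal J := fat_points_idealP P m.
(* [c] is a root of none of the polynomials with coefficients [P i], so the line misses all the
   points. *)
have [|c cP] := @common_nonroot K _ (enum 'I_s) (fun i => rVpoly (P i)).
  by move=> i _; apply: contraNneq (P0 i) => z; rewrite -[P i]rVpolyK z raddf0.
apply: (@line_base_point_free_regular K c w (graded_part J w) (P (Ordinal s_gt0))).
- by split=> //; apply: rpred0.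
- move=> a f g [Jf hf] [Jg hg]; split; last by rewrite rpredD // rpredZ.
  by apply: JD => //; rewrite -mul_mpolyC; apply: JM.
- by move=> f [].
- by move=> f [Jf _]; apply: fat_points_ideal_vanish Jf.
- move=> q q0 lq; have [|f Jf fq] := @fat_points_ideal_separates K s P m q q0.
    (* The line form is zero at [q], hence at its multiples, but not at [P i]. *)
    move=> i a ePi; have := cP i (mem_enum _ _); rewrite ePi linearZ hornerZ.
    by rewrite -meval_line_form lq mulr0 eqxx.
  exact: generators_base_point gens q0 Jf fq.
Qed.

Theorem proposition3p10 (R : realType) (s : nat) (P : 'I_s -> 'rV[R[i]]_3)
    (m : 'I_s -> nat)
    (s_ge1 : (1 <= s)%N)
    (P_neq0 : forall i, P i != 0)
    (P_distinct : forall i j, i != j -> ~ same_point (P i) (P j))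
    (m_ge1 : forall i, (1 <= m i)%N) :
  (beta (fat_points_ideal P m) <= omega (fat_points_ideal P m))%N.
Proof.
set J := fat_points_ideal P m.
have [gs0 gens0] := exists_min_homog_generators (fat_points_idealP P m)
  (fat_points_ideal_graded (m := m)).
(* Minimal generators exist, so [epsilon] returns a genuine value, realized by some [gs]. *)
have [gs gens ->] : is_omega J (omega J).
  by apply: epsilon_spec; exists (\max_(g <- gs0) (msize g).-1), gs0.
have pair := fat_points_regular_pair s_ge1 P_neq0 m_ge1 gens.
(* Minimality in [is_beta] applied to [pair] is the inequality. That a least degree exists follows
   by strong induction from the degree in [pair]. *)
suff [_] : is_beta J (beta J) by apply.
apply: epsilon_spec; have [t [ht mint]] : exists t, has_regular_pair J t /\
    forall u, has_regular_pair J u -> (t <= u)%N.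
  elim/ltn_ind: {pair gens}(\max_(g <- gs) _) pair => t IH ht.
  have [[u [lt_ut hu]]|no] := classic (exists u, (u < t)%N /\ has_regular_pair J u).
    exact: IH lt_ut hu.
  exists t; split=> // u hu; rewrite leqNgt; apply/negP => lt_ut.
  by apply: no; exists u.
by exists t.
Qed.
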